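(* Let $X$ be a compact max-plus convex subset of $\mathbb R^n$ and let $\beta=\beta_X\colon I(X)\to X$ be the idempotent barycenter map. Then the pair $(X,\beta)$ is an $\mathbb I$-algebra, where $\mathbb I=(I,\eta,\zeta)$ is the idempotent probability measure monad.
   Context: For a compact Hausdorff space $X$, $C(X)$ is the Banach space of continuous real-valued functions on $X$ with the sup-norm; $c_X\in C(X)$ is the constant function with value $c\in\mathbb R$; $c\odot\varphi=c_X+\varphi$ for $c\in\mathbb R$, $\varphi\in C(X)$, and $\varphi\oplus\psi=\max\{\varphi,\psi\}$ (pointwise); for real numbers $a\odot b=a+b$, $a\oplus b=\max\{a,b\}$. An idempotent probability measure on $X$ is a functional $\mu\colon C(X)\to\mathbb R$ such that $\mu(c_X)=c$, $\mu(c\odot\varphi)=c\odot\mu(\varphi)$ and $\mu(\varphi\oplus\psi)=\mu(\varphi)\oplus\mu(\psi)$ for all $c\in\mathbb R$, $\varphi,\psi\in C(X)$. $I(X)$ is the set of all idempotent probability measures on $X$ with the weak* topology, whose base consists of the sets $\{\nu\in I(X)\mid |\mu(\varphi_i)-\nu(\varphi_i)|<\varepsilon,\ i=1,\dots,n\}$, where $\mu\in I(X)$, $\varphi_1,\dots,\varphi_n\in C(X)$, $\varepsilon>0$; the space $I(X)$ is compact Hausdorff. For a continuous map $f\colon X\to Y$ of compact Hausdorff spaces, $I(f)\colon I(X)\to I(Y)$ is defined by $I(f)(\mu)(\varphi)=\mu(\varphi\circ f)$, $\varphi\in C(Y)$. The monad $\mathbb I=(I,\eta,\zeta)$ on the category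 of compact Hausdorff spaces: $\eta_X(x)=\delta_x$, where $\delta_x(\varphi)=\varphi(x)$; and $\zeta_X\colon I^2(X)\to I(X)$ is $\zeta_X(M)(\varphi)=M(\bar\varphi)$, where $\bar\varphi\colon I(X)\to\mathbb R$, $\bar\varphi(\mu)=\mu(\varphi)$. For $x,y\in\mathbb R^n$ and $\lambda\in\mathbb R$, $x\oplus y$ is the coordinatewise maximum and $\lambda\odot x$ is obtained from $x$ by adding $\lambda$ to every coordinate. A subset $A\subset\mathbb R^n$ is max-plus convex if $\lambda_1\odot x_1\oplus\lambda_2\odot x_2\in A$ whenever $x_1,x_2\in A$ and $\lambda_1,\lambda_2\in\mathbb R$ with $\max\{\lambda_1,\lambda_2\}=0$. For a compact max-plus convex set $A\subset\mathbb R^n$, the idempotent barycenter map $\beta_A\colon I(A)\to A$ is the continuous map $\beta_A(\mu)=(\mu(x_1|_A),\dots,\mu(x_n|_A))$, where $x_1,\dots,x_n\colon\mathbb R^n\to\mathbb R$ are the coordinate functions. For a monad $\mathbb T=(T,\eta,\mu)$, a $\mathbb T$-algebra is a pair $(X,\xi)$ with a morphism $\xi\colon T(X)\to X$ such that $\xi\circ\eta_X=\mathrm{id}_X$ and $\xi\circ\mu_X=\xi\circ T(\xi)$. *)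

(* Defs.v *)
From HB Require Import structures.
From mathcomp Require Import all_boot all_order all_algebra.
From mathcomp Require Import all_classical all_reals all_analysis.
From mathcomp Require Import lra.

Set Implicit Arguments.
Unset Strict Implicit.
Unset Printing Implicit Defensive.

Import Order.TTheory GRing.Theory Num.Theory.
Import numFieldNormedType.Exports.

Local Open Scope classical_set_scope.
Local Open Scope ring_scope.

HB.mixin Record isCompactHausdorff T & Topological T := {
  compactT : compact [set: T];
  hausdorffT : hausdorff_space T
}.

#[short(type = "compHausType")]
HB.structure Definition CompactHausdorff :=
  {T of Topological T & isCompactHausdorff T}.

(* Monads on the category of compact Hausdorff spaces and continuous maps.
   Equalities of morphisms are stated for the underlying functions. *)
Record monad := Monad {
  mobj :> compHausType -> compHausType;
  mmap : forall X Y : compHausType,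
    continuousType X Y -> continuousType (mobj X) (mobj Y);
  munit : forall X : compHausType, continuousType X (mobj X);
  mmul : forall X : compHausType, continuousType (mobj (mobj X)) (mobj X);
  mmap_id : forall X : compHausType, mmap (@idfun X) = idfun :> (_ -> _);
  mmap_comp : forall (X Y Z : compHausType)
      (f : continuousType X Y) (g : continuousType Y Z),
    mmap (g \o f) = mmap g \o mmap f :> (_ -> _);
  munit_nat : forall (X Y : compHausType) (f : continuousType X Y),
    mmap f \o munit X = munit Y \o f :> (_ -> _);
  mmul_nat : forall (X Y : compHausType) (f : continuousType X Y),
    mmap f \o mmul X = mmul Y \o mmap (mmap f) :> (_ -> _);
  mmul_unitl : forall X : compHausType,
    mmul X \o munit (mobj X) = idfun :> (_ -> _);
  mmul_unitr : forall X : compHausType,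
    mmul X \o mmap (munit X) = idfun :> (_ -> _);
  mmulA : forall X : compHausType,
    mmul X \o mmap (mmul X) = mmul X \o mmul (mobj X) :> (_ -> _)
}.

Record is_algebra (T : monad) (X : compHausType)
    (xi : continuousType (T X) X) : Prop := IsAlgebra {
  alg_unit : xi \o munit T X = idfun :> (X -> X);
  alg_mul : xi \o mmul T X = xi \o mmap T xi :> (T (T X) -> X)
}.

Section MaxPlusFunctions.
Context {R : realType} {X : topologicalType}.

(* [odotf c phi] is c ⊙ phi and [oplusf phi psi] is phi ⊕ psi. *)
Definition odotf (c : R) (phi : X -> R) : X -> R := fun x => c + phi x.

Definition oplusf (phi psi : X -> R) : X -> R :=
  fun x => Num.max (phi x) (psi x).

Lemma odotf_continuous c (phi : continuousType X R) : continuous (odotf c phi).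
Proof. by move=> x; apply: cvgD; [exact: cvg_cst | exact: cts_fun]. Qed.

Lemma oplusf_continuous (phi psi : continuousType X R) :
  continuous (oplusf phi psi).
Proof. by move=> x; apply: continuous_max; exact: cts_fun. Qed.

HB.instance Definition _ c (phi : continuousType X R) :=
  isContinuous.Build X R (odotf c phi) (@odotf_continuous c phi).

HB.instance Definition _ (phi psi : continuousType X R) :=
  isContinuous.Build X R (oplusf phi psi) (@oplusf_continuous phi psi).

End MaxPlusFunctions.

(* Idempotent probability measures; the constant function c_X is [cst c]. *)
Record imeasure (R : realType) (X : topologicalType) := IMeasure {
  imeasure_fun :> continuousType X R -> R;
  imeasure_cst : forall c, imeasure_fun (cst c) = c;
  imeasure_odot : forall c (phi : continuousType X R),
    imeasure_fun (odotf c phi) = c + imeasure_fun phi;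
  imeasure_oplus : forall phi psi : continuousType X R,
    imeasure_fun (oplusf phi psi) =
    Num.max (imeasure_fun phi) (imeasure_fun psi)
}.

Lemma imeasureP (R : realType) (X : topologicalType) (mu nu : imeasure R X) :
  mu =1 nu -> mu = nu.
Proof.
case: mu nu => [m a b c] [m' a' b' c'] /= /funext e.
by rewrite {}e in a b c *; congr IMeasure; exact: Prop_irrelevance.
Qed.

HB.instance Definition _ (R : realType) (X : topologicalType) :=
  gen_eqMixin (imeasure R X).
HB.instance Definition _ (R : realType) (X : topologicalType) :=
  gen_choiceMixin (imeasure R X).

Section WeakStar.
Context {R : realType} {X : topologicalType}.

Definition wstar_ball (mu : imeasure R X) (s : seq (continuousType X R))
    (e : R) : set (imeasure R X) :=
  [set nu | forall phi, phi \in s -> `|mu phi - nu phi| < e].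

Definition wstar_base : set (set (imeasure R X)) :=
  [set U | exists mu s e, 0 < e /\ U = wstar_ball mu s e].

Lemma wstar_ballS (mu nu : imeasure R X) s e : 0 < e -> wstar_ball mu s e nu ->
  exists2 d, 0 < d & wstar_ball nu s d `<=` wstar_ball mu s e.
Proof.
move=> e0; elim: s => [_|phi s IH h]; first by exists 1.
have [|d d0 hd] := IH; first by move=> p ps; apply: h; rewrite inE ps orbT.
have h1 := h phi (mem_head _ _).
exists (Num.min d (e - `|mu phi - nu phi|)).
  by rewrite lt_min d0 subr_gt0.
move=> m hm p; rewrite inE => /orP[/eqP ->|ps].
  have := hm phi (mem_head _ _); rewrite lt_min => /andP[_].
  rewrite ltrBrDl => /(le_lt_trans _); apply.
  by rewrite -[X in `|X|](subrKA (nu phi)) ler_normD.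
apply: hd ps => q qs; have := hm q; rewrite inE qs orbT => /(_ isT).
by rewrite lt_min => /andP[].
Qed.

Lemma wstar_cover : \bigcup_(U in wstar_base) U = setT.
Proof.
rewrite -subTset => mu _; exists (wstar_ball mu [::] 1) => //.
by exists mu, [::], 1.
Qed.

Lemma wstar_join (U V : set (imeasure R X)) mu :
  wstar_base U -> wstar_base V -> U mu -> V mu ->
  exists W, [/\ wstar_base W, W mu & W `<=` U `&` V].
Proof.
move=> [m1 [s1 [e1 [e10 ->]]]] [m2 [s2 [e2 [e20 ->]]]].
move=> /(wstar_ballS e10)[d1 d10 h1] /(wstar_ballS e20)[d2 d20 h2].
have d0 : 0 < Num.min d1 d2 by rewrite lt_min d10.
exists (wstar_ball mu (s1 ++ s2) (Num.min d1 d2)); split.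
- by exists mu, (s1 ++ s2), (Num.min d1 d2).
- by move=> p _; rewrite subrr normr0.
- move=> nu hnu; split; [apply: h1 | apply: h2] => p ps;
    have := hnu p; rewrite mem_cat ps ?orbT => /(_ isT);
    by rewrite lt_min => /andP[].
Qed.

(* The weak* topology: [wstar_base] is its base of open sets. *)
HB.instance Definition _ :=
  isBaseTopological.Build (imeasure R X) wstar_cover wstar_join.

End WeakStar.

Section WeakStarTheory.
Context {R : realType} {X : topologicalType}.

Lemma wstar_ball_nbhs (mu : imeasure R X) s e : 0 < e ->
  nbhs mu (wstar_ball mu s e).
Proof.
move=> e0; rewrite nbhsE; exists (wstar_ball mu s e) => //.
split; last by move=> p _; rewrite subrr normr0.
exists [set wstar_ball mu s e]; last by rewrite bigcup_set1.
by move=> _ ->; exists mu, s, e.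
Qed.

Lemma wstar_cvg (F : set_system (imeasure R X)) (mu : imeasure R X) :
  Filter F -> (forall phi e, 0 < e -> F [set nu | `|mu phi - nu phi| < e]) ->
  F --> mu.
Proof.
move=> FF h A; rewrite nbhsE => -[B [[D sD <-] [U DU Umu]] BA].
have [m [s [e [e0 Ue]]]] := sD _ DU.
have [|d d0 hd] := @wstar_ballS _ _ m mu s e e0; first by rewrite -Ue.
suff Fs : F (wstar_ball mu s d).
  by apply: filterS Fs => nu /hd nuU; apply: BA; exists U => //; rewrite Ue.
elim: s {hd Ue} => [|phi s IH].
  by apply: filterS filterT => nu _ p; rewrite in_nil.
apply: filterS (filterI (h phi d d0) IH) => nu [/= h1 h2] p.
by rewrite inE => /orP[/eqP ->//|]; exact: h2.
Qed.

(* The function written phi with a bar: mu |-> mu phi. *)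
Definition ieval (phi : continuousType X R) : imeasure R X -> R :=
  fun mu => mu phi.

Lemma ieval_continuous phi : continuous (ieval phi).
Proof.
move=> mu; have FF : Filter (nbhs mu) by exact: nbhs_filter.
apply/(cvgrPdist_lt (FF := FF)) => e e0.
have := @wstar_ball_nbhs mu [:: phi] e e0.
apply: (@filterS _ _ (nbhs_filter mu)) => nu; apply.
exact: mem_head.
Qed.

HB.instance Definition _ phi :=
  isContinuous.Build (imeasure R X) R (ieval phi) (@ieval_continuous phi).

Lemma imeasure_continuousP (Y : topologicalType) (f : Y -> imeasure R X) :
  (forall phi, continuous (fun y => f y phi)) -> continuous f.
Proof.
move=> h y; apply: wstar_cvg => phi e e0.
by have /cvgrPdist_lt/(_ e e0) := h phi y.
Qed.

Lemma imeasure_le (mu : imeasure R X) (phi psi : continuousType X R) :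
  (forall x, phi x <= psi x) -> mu phi <= mu psi.
Proof.
move=> h; have -> : psi = oplusf phi psi :> continuousType X R.
  by apply/continuousEP => x; apply/esym; exact: max_r.
by rewrite imeasure_oplus le_max lexx.
Qed.

Lemma imeasure_hausdorff : hausdorff_space (imeasure R X).
Proof.
move=> mu nu clu; apply: imeasureP => phi.
apply: (@norm_hausdorff _ R) => A B Amu Bnu.
have [m [? ?]] := clu _ _ (@ieval_continuous phi mu _ Amu)
                          (@ieval_continuous phi nu _ Bnu).
by exists (m phi).
Qed.

End WeakStarTheory.

Section Compactness.
Context {R : realType} {X : compHausType}.

Lemma bounded_cts (phi : continuousType X R) :
  exists M : R, forall x, `|phi x| <= M.
Proof.
have : compact (phi @` [set: X]).
  apply: continuous_compact; last exact: compactT.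
  by apply: continuous_subspaceT; exact: cts_fun.
move/compact_bounded => [M [_ h]].
exists (M + 1) => x; apply: (h (M + 1)); first by rewrite ltrDl.
by exists x.
Qed.

Lemma imeasure_compact : compact [set: imeasure R X].
Proof.
rewrite compact_ultra => F FU _.
have lim (phi : continuousType X R) : exists l : R, ieval phi @ F --> l.
  have [M hM] := bounded_cts phi.
  have : compact [set` `[- M, M]] by exact: segment_compact.
  move=> /(_ (ieval phi @ F)) [|l [_ cl]].
  - change (F (ieval phi @^-1` [set` `[- M, M]])).
    apply: filterS filterT => mu _; rewrite /= in_itv/=; apply/andP; split.
      rewrite -(imeasure_cst mu (- M)); apply: imeasure_le => x /=.
      by have := hM x; rewrite ler_norml => /andP[].
    rewrite -(imeasure_cst mu M); apply: imeasure_le => x /=.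
    by have := hM x; rewrite ler_norml => /andP[].
  - exists l => U Ul; have [//|FC] := in_ultra_setVsetC (ieval phi @^-1` U) FU.
    by have [y []] := cl (~` U) U FC Ul.
pose l phi := sval (cid (lim phi)).
have lP phi : ieval phi @ F --> l phi := svalP (cid (lim phi)).
have lU phi z : ieval phi @ F --> z -> l phi = z.
  by apply: cvg_unique => //; exact: lP.
have h1 c : l (cst c) = c.
  apply: lU; rewrite (_ : ieval _ = cst c); first exact: cvg_cst.
  by apply/funext => mu; exact: imeasure_cst.
have h2 c (phi : continuousType X R) : l (odotf c phi) = c + l phi.
  apply: lU; rewrite (_ : ieval _ = fun mu => c + ieval phi mu).
    by apply: cvgD; [exact: cvg_cst | exact: lP].
  by apply/funext => mu; exact: imeasure_odot.
have h3 (phi psi : continuousType X R) :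
    l (oplusf phi psi) = Num.max (l phi) (l psi).
  apply: lU.
  rewrite (_ : ieval _ = fun mu => Num.max (ieval phi mu) (ieval psi mu)).
    under eq_fun do rewrite maxr_absE.
    rewrite maxr_absE; apply: cvgM; last exact: cvg_cst.
    apply: cvgD; first by apply: cvgD; exact: lP.
    by apply: cvg_norm; apply: cvgB; exact: lP.
  by apply/funext => mu; exact: imeasure_oplus.
exists (IMeasure h1 h2 h3); split=> //; apply: wstar_cvg => phi e e0 /=.
by have /cvgrPdist_lt/(_ e e0) := lP phi.
Qed.

HB.instance Definition _ := isCompactHausdorff.Build (imeasure R X)
  imeasure_compact imeasure_hausdorff.

End Compactness.

Section Functor.
Context {R : realType}.

Section Map.
Context {X Y : topologicalType} (f : continuousType X Y).

Definition imap_fun (mu : imeasure R X) (phi : continuousType Y R) : R :=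
  mu (phi \o f).

Lemma imap_cst mu c : imap_fun mu (cst c) = c.
Proof.
rewrite /imap_fun (_ : _ \o _ = cst c :> continuousType X R).
  exact: imeasure_cst.
exact/continuousEP.
Qed.

Lemma imap_odot mu c (phi : continuousType Y R) :
  imap_fun mu (odotf c phi) = c + imap_fun mu phi.
Proof. by rewrite -imeasure_odot; congr (mu _); exact/continuousEP. Qed.

Lemma imap_oplus mu (phi psi : continuousType Y R) :
  imap_fun mu (oplusf phi psi) = Num.max (imap_fun mu phi) (imap_fun mu psi).
Proof. by rewrite -imeasure_oplus; congr (mu _); exact/continuousEP. Qed.

Definition imap (mu : imeasure R X) : imeasure R Y :=
  IMeasure (imap_cst mu) (imap_odot mu) (imap_oplus mu).

Lemma imap_continuous : continuous imap.
Proof.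
apply: imeasure_continuousP => phi.
exact: (@ieval_continuous R X (phi \o f)).
Qed.

HB.instance Definition _ := isContinuous.Build _ _ imap imap_continuous.

End Map.

Section Unit.
Context {X : topologicalType}.

Definition dirac_im (x : X) : imeasure R X :=
  @IMeasure R X (fun phi => phi x) (fun=> erefl) (fun _ _ => erefl)
    (fun _ _ => erefl).

Lemma dirac_im_continuous : continuous dirac_im.
Proof. by apply: imeasure_continuousP => phi; exact: cts_fun. Qed.

HB.instance Definition _ := isContinuous.Build _ _ dirac_im dirac_im_continuous.

End Unit.

Section Mult.
Context {X : topologicalType}.

Definition imul_fun (M : imeasure R (imeasure R X)) (phi : continuousType X R)
  : R := M (ieval phi).

Lemma imul_cst M c : imul_fun M (cst c) = c.
Proof.
rewrite /imul_fun (_ : ieval _ = cst c :> continuousType _ R).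
  exact: imeasure_cst.
by apply/continuousEP => mu; exact: imeasure_cst.
Qed.

Lemma imul_odot M c (phi : continuousType X R) :
  imul_fun M (odotf c phi) = c + imul_fun M phi.
Proof.
rewrite -imeasure_odot; congr (M _); apply/continuousEP => mu.
exact: imeasure_odot.
Qed.

Lemma imul_oplus M (phi psi : continuousType X R) :
  imul_fun M (oplusf phi psi) = Num.max (imul_fun M phi) (imul_fun M psi).
Proof.
rewrite -imeasure_oplus; congr (M _); apply/continuousEP => mu.
exact: imeasure_oplus.
Qed.

(* The multiplication zeta of the monad. *)
Definition imul (M : imeasure R (imeasure R X)) : imeasure R X :=
  IMeasure (imul_cst M) (imul_odot M) (imul_oplus M).

Lemma imul_continuous : continuous imul.
Proof.
apply: imeasure_continuousP => phi; exact: (@ieval_continuous R _ (ieval phi)).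
Qed.

HB.instance Definition _ := isContinuous.Build _ _ imul imul_continuous.

End Mult.
End Functor.

Section IMonad.
Context (R : realType).

Lemma imap_id (X : compHausType) :
  imap (@idfun X) = idfun :> (imeasure R X -> imeasure R X).
Proof.
apply/funext => mu; apply: imeasureP => phi.
by congr (mu _); exact/continuousEP.
Qed.

Lemma imap_comp (X Y Z : compHausType)
    (f : continuousType X Y) (g : continuousType Y Z) :
  imap (g \o f) = imap g \o imap f :> (imeasure R X -> imeasure R Z).
Proof.
apply/funext => mu; apply: imeasureP => phi.
by congr (mu _); exact/continuousEP.
Qed.

Lemma dirac_nat (X Y : compHausType) (f : continuousType X Y) :
  imap f \o dirac_im = dirac_im \o f :> (X -> imeasure R Y).
Proof. by apply/funext => x; exact: imeasureP. Qed.

Lemma imul_nat (X Y : compHausType) (f : continuousType X Y) :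
  imap f \o imul = imul \o imap (imap f)
    :> (imeasure R (imeasure R X) -> imeasure R Y).
Proof.
apply/funext => M; apply: imeasureP => phi.
by congr (M _); exact/continuousEP.
Qed.

Lemma imul_unitl (X : compHausType) :
  imul \o dirac_im = idfun :> (imeasure R X -> imeasure R X).
Proof. by apply/funext => mu; exact: imeasureP. Qed.

Lemma imul_unitr (X : compHausType) :
  imul \o imap dirac_im = idfun :> (imeasure R X -> imeasure R X).
Proof.
apply/funext => mu; apply: imeasureP => phi.
by congr (mu _); exact/continuousEP.
Qed.

Lemma imulA (X : compHausType) :
  imul \o imap imul = imul \o imul
    :> (imeasure R (imeasure R (imeasure R X)) -> imeasure R X).
Proof.
apply/funext => M; apply: imeasureP => phi.
by congr (M _); exact/continuousEP.
Qed.

Definition idem_monad : monad :=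
  @Monad (fun X => imeasure R X : compHausType)
    (fun X Y f => imap f : continuousType _ _)
    (fun X => dirac_im : continuousType _ _)
    (fun X => imul : continuousType _ _)
    imap_id imap_comp dirac_nat imul_nat imul_unitl imul_unitr imulA.

End IMonad.

Section SubsetSpace.
Context {R : realType} {n : nat}.
Implicit Types A : set 'rV[R]_n.

Lemma set_type_compact A : compact A -> compact [set: A].
Proof.
move=> cA F FF _.
have FA : (set_val @ F) A.
  by change (F (set_val @^-1` A)); apply: filterS filterT => x _; exact: set_valP.
have [p [Ap cl]] := cA _ _ FA.
exists (SigSub (mem_set Ap)); split=> // B C FB [D [[W oW <-] Wp] DC].
have FB' : (set_val @ F) (set_val @` B).
  change (F (set_val @^-1` (set_val @` B))).
  by apply: filterS FB => b Bb; exists b.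
have Wn : nbhs p W by exact: open_nbhs_nbhs.
have [q [[b Bb <-] Wb]] := cl _ _ FB' Wn.
by exists b; split=> //; exact: DC.
Qed.

Lemma set_type_hausdorff A : hausdorff_space A.
Proof.
move=> x y cl; apply/val_inj/rowP => i.
pose f (z : A) : R := (\val z) ord0 i.
have fc : continuous f.
  move=> z; apply: (@continuous_comp _ _ _ set_val (fun v : 'rV[R]_n => v ord0 i)).
    exact: initial_continuous.
  exact: coord_continuous.
apply: (@norm_hausdorff _ R) => B C Bx Cy.
by have [z [? ?]] := cl _ _ (fc x _ Bx) (fc y _ Cy); exists (f z).
Qed.

(* A compact subset of R^n with its subspace topology. *)
Definition subCompHaus A (cA : compact A) : compHausType :=
  HB.pack (set_type A) (isCompactHausdorff.Build (set_type A)
    (set_type_compact cA) (@set_type_hausdorff A)).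

Definition coordf A (i : 'I_n) : A -> R := fun x => (\val x) ord0 i.

Lemma coordf_continuous A i : continuous (@coordf A i).
Proof.
move=> z; apply: (@continuous_comp _ _ _ set_val (fun v : 'rV[R]_n => v ord0 i)).
  exact: initial_continuous.
exact: coord_continuous.
Qed.

HB.instance Definition _ A i :=
  isContinuous.Build _ _ (@coordf A i) (@coordf_continuous A i).

Definition odotv (c : R) (x : 'rV[R]_n) : 'rV[R]_n := \row_i (c + x ord0 i).

Definition oplusv (x y : 'rV[R]_n) : 'rV[R]_n :=
  \row_i Num.max (x ord0 i) (y ord0 i).

Definition maxplus_convex A :=
  forall (x1 x2 : 'rV[R]_n) (l1 l2 : R), A x1 -> A x2 -> Num.max l1 l2 = 0 ->
    A (oplusv (odotv l1 x1) (odotv l2 x2)).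

End SubsetSpace.

Lemma imeasure_lt (R : realType) (X : compHausType) (mu : imeasure R X)
    (phi psi : continuousType X R) :
  (forall x, phi x < psi x) -> mu phi < mu psi.
Proof.
move=> h; have [[x0 _]|X0] := pselect (exists x : X, True); last first.
  have -> : psi = odotf 1 phi :> continuousType X R.
    by apply/continuousEP => x; case: X0; exists x.
  by rewrite imeasure_odot ltrDr.
have c : {within [set: X], continuous (fun x => psi x - phi x)}.
  by apply: continuous_subspaceT => x; apply: cvgB; exact: cts_fun.
have [|y _ hy] := compact_EVT_min _ (@compactT X) c; first by exists x0.
have e0 : 0 < psi y - phi y by rewrite subr_gt0.
apply: (@lt_le_trans _ _ (mu (odotf (psi y - phi y) phi))).
  by rewrite imeasure_odot ltrDr.
apply: imeasure_le => x; rewrite /odotf/= -lerBrDr.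
by apply: hy; rewrite inE.
Qed.

Section Barycenter.
Context {R : realType} {n : nat} (A : set 'rV[R]_n).
Context (cA : compact A) (mA : maxplus_convex A).

Definition barycenter_vec (mu : imeasure R A) : 'rV[R]_n :=
  \row_i mu (coordf i).

Lemma barycenter_vec_in mu : A (barycenter_vec mu).
Proof.
have pE i : mu (coordf i) = barycenter_vec mu ord0 i by rewrite mxE.
move: (barycenter_vec mu) pE => p pE.
pose h i : continuousType A R := odotf (- p ord0 i) (coordf i).
have muh i : mu (h i) = 0 by rewrite imeasure_odot pE addNr.
pose g c : continuousType A R :=
  foldr (fun i (acc : continuousType A R) => oplusf (h i) acc : continuousType A R) (cst c) (enum 'I_n).
have gc c x : c <= g c x.
  rewrite /g; elim: (enum _) => //= i s IH.
  by rewrite /oplusf le_max IH orbT.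
have gh c i x : h i x <= g c x.
  rewrite /g; have : i \in enum 'I_n by rewrite mem_enum.
  elim: (enum _) => //= j s IH; rewrite inE /oplusf le_max.
  by move=> /orP[/eqP <-|/IH ->]; rewrite ?lexx ?orbT.
have mug c : c <= 0 -> mu (g c) <= 0.
  move=> c0; rewrite /g; elim: (enum _) => [|i s IH] /=.
    by rewrite imeasure_cst.
  by rewrite imeasure_oplus ge_max muh lexx.
have muLT := @imeasure_lt R (subCompHaus cA) mu.
suff [q [Aq qp eq]] : exists q, [/\ A q, forall j, q ord0 j <= p ord0 j &
    forall i, i \in enum 'I_n -> q ord0 i = p ord0 i].
  rewrite (_ : p = q) //; apply/rowP => i.
  by rewrite eq// mem_enum.
elim: (enum _) => [|i s [q [Aq qp eq]]].
  apply: contrapT => H.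
  have : mu (cst 0) < mu (g (-1)).
    apply: muLT => x /=; apply: contrapT => /negP; rewrite -leNgt => gx.
    apply: H; exists (\val x); split=> //; first exact: set_valP.
    move=> j; rewrite -subr_le0 addrC.
    exact: le_trans (gh (-1) j x) gx.
  by rewrite imeasure_cst ltNge mug// lerN10.
have [a ha] : exists a : A, g 0 a <= h i a.
  apply: contrapT => H.
  have : mu (h i) < mu (g 0).
    by apply: muLT => x; rewrite ltNge; apply/negP => ?; apply: H; exists x.
  by rewrite muh ltNge mug.
pose l := p ord0 i - (\val a) ord0 i.
have hE j : h j a = - p ord0 j + (\val a) ord0 j by [].
have l0 : l <= 0.
  have := le_trans (gc 0 a) ha; rewrite hE addrC subr_ge0 => ?.
  by rewrite /l subr_le0.
have lj j : l + (\val a) ord0 j <= p ord0 j.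
  have := le_trans (gh 0 j a) ha; rewrite !hE /l => ?.
  by lra.
exists (oplusv (odotv 0 q) (odotv l (\val a))); split.
- by apply: mA => //; [exact: set_valP | rewrite max_l].
- by move=> j; rewrite !mxE add0r ge_max qp lj.
- move=> j; rewrite inE !mxE add0r => /orP[/eqP ->|js].
    by rewrite /l subrK max_r.
  by rewrite eq// max_l.
Qed.

Definition barycenter (mu : imeasure R A) : A :=
  SigSub (mem_set (barycenter_vec_in mu)).

Lemma barycenter_continuous : continuous barycenter.
Proof.
apply: (@continuous_comp_initial _ _ _ set_val) => mu U [P hP PU].
have FF : Filter (nbhs mu) by exact: nbhs_filter.
have : \forall nu \near mu, forall ij : 'I_1 * 'I_n,
    P ij.1 ij.2 (barycenter_vec nu ij.1 ij.2).
  apply: (@filter_forall _ _ _ _ FF) => -[i j] /=.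
  have := hP i j; rewrite !mxE => hPij.
  have := @ieval_continuous R A (coordf j) mu _ hPij.
  by apply: (@filterS _ _ FF) => nu; rewrite /= mxE.
by apply: (@filterS _ _ FF) => nu h; apply: PU => i j; exact: (h (i, j)).
Qed.

HB.instance Definition _ :=
  isContinuous.Build _ _ barycenter barycenter_continuous.

End Barycenter.

(* Main.v *)
Require Import Defs.
From mathcomp Require Import all_boot all_order all_algebra.
From mathcomp Require Import all_classical all_reals all_analysis.
Import numFieldNormedType.Exports.

Local Open Scope classical_set_scope.
Local Open Scope ring_scope.

(** The coordinate functions separate the points of [X], and the barycenter
    is the map that turns them into evaluations: [x_i \o beta] is the function
    [mu |-> mu x_i] on [I(X)] ([coordf_barycenter]).  Both algebra laws can
    therefore be read off coordinate by coordinate.  The unit law becomes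
    [delta_x x_i = x_i x].  In the multiplication law, the [i]-th coordinate
    of [beta (zeta M)] is the value of [M] at the evaluation at [x_i], that of
    [beta (I(beta) M)] is the value of [M] at [x_i \o beta], and these two
    arguments of [M] are the same continuous function. *)

Section Coordinates.
Context {R : realType} {n : nat} {A : set 'rV[R]_n}.

Lemma coordf_inj (x y : A) : (forall i, coordf i x = coordf i y) -> x = y.
Proof. by move=> xy; apply/val_inj/rowP => i; exact: xy. Qed.

Lemma coordf_barycenter (cA : compact A) (mA : maxplus_convex A)
    (mu : imeasure R A) i :
  coordf i (barycenter cA mA mu) = mu (coordf i).
Proof. by rewrite /coordf /= mxE. Qed.

End Coordinates.

Theorem proposition3p5 (R : realType) (n : nat) (X : set 'rV[R]_n)
    (cX : compact X) (mX : maxplus_convex X) :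
  is_algebra (T := idem_monad R) (X := subCompHaus cX) (barycenter cX mX).
Proof.
split.
  by apply/funext => x; apply: coordf_inj => i; rewrite /= coordf_barycenter.
apply/funext => M; apply: coordf_inj => i /=.
rewrite !coordf_barycenter /= /imul_fun /imap_fun.
congr (M _); apply/continuousEP => mu /=.
by rewrite coordf_barycenter.
Qed.
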